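(* Let $G\in\mathcal{F}_2$ and let $(G,w)$ be an $8$-unbalanced pair. Assume $G$ admits no star cutset. Let $K_1,K_2,K_1',K_2'$ be cliques of $G$ such that $S(K_1,K_2)$ and $S(K_1',K_2')$ are active. Then $S(K_1,K_2)$ and $S(K_1',K_2')$ are loosely non-crossing, i.e. $A(K_1,K_2)\cap(K_1'\cup K_2')=\emptyset$ and $A(K_1',K_2')\cap(K_1\cup K_2)=\emptyset$.
   Context: A hole is an induced cycle of length at least four. $G$ is sparse if for every hole $H$ and vertex $v\notin V(H)$ there is an edge $ab$ of $H$ with $N(v)\cap V(H)\subseteq\{a,b\}$. Pyramids and prisms: a pyramid consists of a vertex $a$, a triangle $\{b_1,b_2,b_3\}$ and paths $P_i$ from $a$ to $b_i$ of length $\ge1$ with $P_i\setminus\{a\}$ pairwise disjoint, the only edge between $P_i\setminus\{a\}$ and $P_j\setminus\{a\}$ ($i\ne j$) being $b_ib_j$, and at most one $P_i$ of length one; a prism consists of disjoint triangles $\{a_1,a_2,a_3\},\{b_1,b_2,b_3\}$ and pairwise disjoint paths $P_i$ from $a_i$ to $b_i$ of length $\ge1$ with the only edges between $P_i,P_j$ ($i\ne j$) being $a_ia_j,b_ib_j$. $\mathcal{F}_2$ is the class of triangle-free sparse graphs with no induced pyramid or prism (so all cliques have size at most 2). A separation is a partition $(A,C,B)$ of $V(G)$ with no edges between $A$ and $B$; star separation if some $v\in C$ has $C\subseteq N[v]$; proper if $A,B\neq\emptyset$; $G$ admits a star cutset if it has a proper star separation. A weight function is $w:V(G)\to[0,1]$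 summing to $1$; $(G,w)$ is $d$-unbalanced if no set $X$ with $|X|\le d$ has every component $D$ of $G\setminus X$ of weight $\le\frac12$. For cliques $K_1,K_2$: $B(K_1,K_2)$ is the unique maximum-weight component of $G\setminus(K_1\cup K_2)$ (weight $>\frac12$), $A(K_1,K_2)=V(G)\setminus(B(K_1,K_2)\cup K_1\cup K_2)$, $S(K_1,K_2)=(A(K_1,K_2),K_1\cup K_2,B(K_1,K_2))$. $S(K_1,K_2)$ is proper if some component $D$ of $G[A(K_1,K_2)]$ has $K_1\cup K_2\subseteq N(D)$, and, if $|K_1|=|K_2|=1$, $G[A(K_1,K_2)\cup K_1\cup K_2]$ is not a path between the vertices of $K_1$ and $K_2$. It is active if it is proper and for all cliques $K_1',K_2'$ with $S(K_1',K_2')$ proper and $K_1'\cup K_2'\ne K_1\cup K_2$: $B(K_1',K_2')\cup K_1'\cup K_2'$ is not a proper subset of $B(K_1,K_2)\cup K_1\cup K_2$, and if these two sets are equal then $B(K_1',K_2')\subseteq B(K_1,K_2)$. *)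

(* Defs.v *)
From mathcomp Require Import all_boot all_order all_algebra.
Set Implicit Arguments.
Unset Strict Implicit.
Unset Printing Implicit Defensive.
Import Order.TTheory GRing.Theory Num.Theory.
Local Open Scope ring_scope.

(* A finite simple graph is a symmetric irreflexive relation [e] on a finite
   type [T]; both properties are hypotheses of the theorem. *)
Section Graphs.
Variables (T : finType) (e : rel T).
Implicit Types (A B C D K S X : {set T}) (s c : seq T).

Definition clique K : Prop := {in K &, forall x y, x != y -> e x y}.

Definition closed_nbhd (v : T) : {set T} := [set u | (u == v) || e v u].

Definition nbhd_set D : {set T} :=
  [set v | (v \notin D) && [exists u in D, e u v]].

Definition component_of S (x : T) : {set T} :=
  [set y in S | connect [rel u v | [&& u \in S, v \in S & e u v]] x y].

(* The vertex sets of the connected components of the induced subgraph G[S]. *)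
Definition components S : {set {set T}} := [set component_of S x | x in S].

(* [s] lists, in order, the vertices of an induced path of G from [x] to [y];
   the length of the path is [(size s).-1]. *)
Definition induced_path s (x y : T) : Prop :=
  [/\ uniq s, ohead s = Some x, last x s = y &
      {in s &, forall u v,
         e u v = (index v s == (index u s).+1) || (index u s == (index v s).+1)}].

(* [c] lists, in cyclic order, the vertices of an induced cycle of length at
   least four. *)
Definition hole c : Prop :=
  [/\ uniq c, (4 <= size c)%N &
      {in c &, forall u v, e u v = (next c u == v) || (next c v == u)}].

Definition sparse : Prop :=
  forall c (v : T), hole c -> v \notin c ->
  exists a b : T, [/\ a \in c, b \in c, e a b &
    forall u, u \in c -> e v u -> u = a \/ u = b].

Definition triangle_free : Prop := ~ exists x y z : T, [/\ e x y, e y z & e x z].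

Definition induced_pyramid (a : T) (b : 'I_3 -> T) (P : 'I_3 -> seq T) : Prop :=
  [/\ forall i j, i != j -> e (b i) (b j),
      forall i, induced_path (P i) a (b i) /\ (1 <= (size (P i)).-1)%N,
      forall i j x, i != j -> x \in P i -> x \in P j -> x = a,
      forall i j x y, i != j -> x \in P i -> y \in P j -> x != a -> y != a ->
        e x y -> x = b i /\ y = b j
    & forall i j, (size (P i)).-1 = 1%N -> (size (P j)).-1 = 1%N -> i = j].

Definition induced_prism (a b : 'I_3 -> T) (P : 'I_3 -> seq T) : Prop :=
  [/\ forall i j, i != j -> e (a i) (a j) /\ e (b i) (b j),
      forall i j, a i != b j,
      forall i, induced_path (P i) (a i) (b i) /\ (1 <= (size (P i)).-1)%N,
      forall i j x, i != j -> x \in P i -> x \notin P j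
    & forall i j x y, i != j -> x \in P i -> y \in P j -> e x y ->
        (x = a i /\ y = a j) \/ (x = b i /\ y = b j)].

Definition class_F2 : Prop :=
  [/\ triangle_free, sparse,
      ~ exists a b P, induced_pyramid a b P
    & ~ exists a b P, induced_prism a b P].

(* The parts of the partition may be empty. *)
Definition separation A C B : Prop :=
  [/\ A :|: C :|: B = [set: T],
      [disjoint A & C], [disjoint A & B], [disjoint C & B]
    & forall x y, x \in A -> y \in B -> ~~ e x y].

Definition star_separation A C B : Prop :=
  separation A C B /\ exists2 v, v \in C & C \subset closed_nbhd v.

Definition star_cutset : Prop :=
  exists A C B, [/\ star_separation A C B, A != set0 & B != set0].

Variables (R : realFieldType) (w : T -> R).

Definition weight_function : Prop :=
  (forall x, 0 <= w x <= 1) /\ \sum_x w x = 1.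

Definition weight D : R := \sum_(x in D) w x.

Definition unbalanced (d : nat) : Prop :=
  ~ exists X, (#|X| <= d)%N /\
      forall D, D \in components (~: X) -> weight D <= 2^-1.

Variables K1 K2 : {set T}.

(* The maximum-weight component of G \ (K1 u K2); [heavy_componentP] below shows
   that it exists and is unique in an unbalanced pair. *)
Definition Bpart : {set T} :=
  odflt set0 [pick D in components (~: (K1 :|: K2)) |
    [forall D' in components (~: (K1 :|: K2)), weight D' <= weight D]].

Definition Apart : {set T} := ~: (Bpart :|: K1 :|: K2).

Definition proper_sep : Prop :=
  (exists2 D, D \in components Apart & K1 :|: K2 \subset nbhd_set D) /\
  (forall x y, K1 = [set x] -> K2 = [set y] ->
     ~ exists s, induced_path s x y /\ [set z in s] = Apart :|: K1 :|: K2).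

End Graphs.

Section Active.
Variables (T : finType) (e : rel T) (R : realFieldType) (w : T -> R).

Definition active_sep (K1 K2 : {set T}) : Prop :=
  proper_sep e w K1 K2 /\
  forall K1' K2' : {set T}, clique e K1' -> clique e K2' ->
    proper_sep e w K1' K2' -> K1' :|: K2' <> K1 :|: K2 ->
    let U := Bpart e w K1 K2 :|: K1 :|: K2 in
    let U' := Bpart e w K1' K2' :|: K1' :|: K2' in
    ~~ (U' \proper U) /\
    (U' = U -> Bpart e w K1' K2' \subset Bpart e w K1 K2).

Definition loosely_non_crossing (K1 K2 K1' K2' : {set T}) : Prop :=
  Apart e w K1 K2 :&: (K1' :|: K2') = set0 /\
  Apart e w K1' K2' :&: (K1 :|: K2) = set0.

End Active.

Section HeavyComponent.
Variables (T : finType) (e : rel T) (R : realFieldType) (w : T -> R).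
Hypotheses (e_sym : symmetric e) (w_weight : weight_function w).

Lemma components_trivI (S C D : {set T}) : C \in components e S ->
  D \in components e S -> C != D -> [disjoint C & D].
Proof.
move=> /imsetP[x xS ->] /imsetP[y yS ->]; apply: contraR => /pred0Pn[z /=].
rewrite !inE => /andP[/andP[_ xz] /andP[_ yz]].
set r := [rel _ _ | _] in xz yz.
have cs : connect_sym r.
  by apply: sym_connect_sym => u v /=; rewrite andbCA e_sym.
have xy : connect r x y by apply: connect_trans xz _; rewrite cs.
apply/eqP/setP=> u; rewrite !inE -/r; congr (_ && _).
exact: (same_connect cs xy).
Qed.

Lemma heavy_componentP (d : nat) (K1 K2 : {set T}) :
  unbalanced e w d -> (#|K1 :|: K2| <= d)%N ->
  let CC := components e (~: (K1 :|: K2)) in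
  let B := Bpart e w K1 K2 in
  [/\ B \in CC, 2^-1 < weight w B
    & {in CC, forall D, D != B -> weight w D < weight w B}].
Proof.
move=> unb cardK CC B; have [w01 w1] := w_weight.
have [D DC Dhalf] : exists2 D, D \in CC & 2^-1 < weight w D.
  apply/exists_inP; apply: contraT => /exists_inPn h; case: unb.
  by exists (K1 :|: K2); split=> // D /h; rewrite -leNgt.
have sub1 C C' : C \in CC -> C' \in CC -> C != C' ->
    weight w C + weight w C' <= 1.
  move=> Cc Cc' ne; have dis := components_trivI Cc Cc' ne.
  rewrite /weight -w1 -bigU //= [X in _ <= X](bigID [predU C & C']) /= lerDl.
  by apply: sumr_ge0 => x _; case/andP: (w01 x).
have light C : C \in CC -> C != D -> weight w C < 2^-1.
  move=> Cc ne; have := sub1 _ _ Cc DC ne.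
  rewrite -lerBrDr => /le_lt_trans; apply.
  by rewrite ltrBlDr -ltrBlDl; rewrite {1}[1](splitr 1) !mul1r addrK.
have -> : B = D.
  rewrite /B /Bpart -/CC; case: pickP => [C /andP[Cc /forall_inP h]|/(_ D)] /=.
    apply/eqP; apply: contraT => ne; have := h _ DC.
    by rewrite leNgt (lt_trans (light _ Cc ne) Dhalf).
  rewrite DC /= => /negP[]; apply/forall_inP => C Cc.
  by have [->//|ne] := eqVneq C D; rewrite ltW // (lt_trans (light _ Cc ne)).
by split=> // C Cc ne; apply: lt_trans (light _ Cc ne) Dhalf.
Qed.

End HeavyComponent.

(* Main.v *)
Require Import Defs.
From mathcomp Require Import all_boot all_order all_algebra zify.
Set Implicit Arguments.
Unset Strict Implicit.
Unset Printing Implicit Defensive.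
Import Order.TTheory GRing.Theory Num.Theory.

(* Write [K = K1 :|: K2], [A], [B] for the first separation and [L = L1 :|: L2],
   [A'], [B'] for the second. As [~: A] is [B :|: K], activity makes [A] maximal
   among the left sides of proper separations. Hence every vertex of [K] has a
   neighbour in [B], and [A' = A] as soon as [L] misses [B].

   So if [L] meets [A], then [L] meets [B] and [K] meets [B']. The connected sets
   [D \subset A] and [E \subset A'] attached to all of [K] and of [L] then give,
   up to exchanging the cliques of a pair, [x] in [K1 :&: E], [y] in [K2 :&: B'],
   [x'] in [L1 :&: D] and [y'] in [L2 :&: B].
   If [K1] and [L1] share a vertex [p], a path from [x] to [x'] through
   [A :&: A'] and one through the vertices outside [A :&: A'] form a hole that
   contains two neighbours of [p], against sparsity. Otherwise the heavy side of
   [K2] and [L2] lies in [B :&: B'], so that [K2] and [L2] define a proper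
   separation whose left side contains [A] and [x], against maximality. *)

Lemma eq_head_index (T : eqType) (s : seq T) y v :
  ohead s = Some y -> (v == y) = (index v s == 0).
Proof. by case: s => //= z s [<-]; rewrite eq_sym; case: eqP. Qed.

Lemma eq_last_index (T : eqType) (s : seq T) x u :
  uniq s -> u \in s -> (u == last x s) = (index u s == (size s).-1).
Proof.
case: s => // z s us su; have := index_last us; rewrite /= => <-.
by rewrite (inj_in_eq (@index_inj _ z (z :: s))) // mem_last.
Qed.

Section Graph.
Variables (T : finType) (e : rel T).
Hypotheses (e_sym : symmetric e) (e_irr : irreflexive e).
Implicit Types (C D K L Q S : {set T}) (s t : seq T).

(** * Connected sets *)

Definition induced_rel S : rel T := [rel u v | [&& u \in S, v \in S & e u v]].

Definition connected_set C : Prop :=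
  {in C &, forall u v, connect (induced_rel C) u v}.

Lemma induced_relE S u v : induced_rel S u v = [&& u \in S, v \in S & e u v].
Proof. by []. Qed.

Lemma connect_induced_rel_sym S : connect_sym (induced_rel S).
Proof. by apply: sym_connect_sym => u v; rewrite !induced_relE andbCA e_sym. Qed.

Lemma connect_induced_relS S S' x y : S \subset S' ->
  connect (induced_rel S) x y -> connect (induced_rel S') x y.
Proof.
move=> /subsetP SS'; apply: connect_sub => u v /and3P[uS vS euv].
by apply: connect1; rewrite induced_relE !SS'.
Qed.

Lemma connected_set_center C x :
  {in C, forall u, connect (induced_rel C) x u} -> connected_set C.
Proof.
move=> xC u v /xC xu /xC; apply: connect_trans.
by rewrite connect_induced_rel_sym.
Qed.

Lemma connected_set1 x : connected_set [set x].
Proof. by move=> u v /set1P-> /set1P->; apply: connect0. Qed.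

Lemma connected_setU C D u v : connected_set C -> connected_set D ->
  u \in C -> v \in D -> e u v -> connected_set (C :|: D).
Proof.
move=> cC cD uC vD euv; apply: (@connected_set_center _ u) => z.
case/setUP=> [zC|zD].
  by apply: connect_induced_relS (cC u z uC zC); apply: subsetUl.
apply: (@connect_trans _ _ v).
  by apply: connect1; rewrite induced_relE !inE uC vD orbT.
by apply: connect_induced_relS (cD v z vD zD); apply: subsetUr.
Qed.

Lemma connected_setU1 C x u : connected_set C -> u \in C -> e x u ->
  connected_set (x |: C).
Proof.
by move=> cC; apply: connected_setU cC (set11 x); apply: connected_set1.
Qed.

Lemma connected_set_sub C Q x : connected_set C -> x \in C -> x \in Q ->
  {in C &, forall u v, e u v -> u \in Q -> v \in Q} -> C \subset Q.
Proof.
move=> cC xC xQ closedQ; apply/subsetP=> y yC.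
have /connectP[p xp ->] := cC x y xC yC.
elim: p x xC xQ xp => [|z p IH] x xC xQ //= /andP[/and3P[_ zC exz]].
by apply: IH; rewrite ?(closedQ x z).
Qed.

Lemma connected_setU1I D Q x : connected_set D -> x \in D ->
  {in D &, forall u v, e u v -> u \in Q -> v \in Q \/ v = x} ->
  connected_set (x |: D :&: Q).
Proof.
move=> cD xD leaveQ; set S := x |: D :&: Q.
have inS u : u \in D -> u \in Q -> u \in S.
  by move=> uD uQ; rewrite !inE uD uQ orbT.
apply: (@connected_set_center _ x) => z /setU1P[->|/setIP[zD zQ]].
  exact: connect0.
pose reached := [set u | (u \in Q) ==> connect (induced_rel S) x u].
suff /subsetP/(_ z zD) : D \subset reached by rewrite inE zQ.
apply: (connected_set_sub cD xD); first by rewrite inE connect0 implybT.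
move=> u v uD vD euv; rewrite !inE => /implyP xu; apply/implyP=> vQ.
have /andP[uS xu'] : (u \in S) && connect (induced_rel S) x u.
  have evu : e v u by rewrite e_sym.
  have [uQ|->] := leaveQ v u vD uD evu vQ; first by rewrite inS ?xu.
  by rewrite setU11 connect0.
by apply: connect_trans xu' (connect1 _); rewrite induced_relE uS euv inS.
Qed.

Lemma sorted_connected_set s : sorted e s -> connected_set [set:: s].
Proof.
elim: s => [_ u|x s IH xs]; first by rewrite inE.
rewrite set_cons; have cs := IH (path_sorted xs).
case: s xs cs {IH} => [_ _|y s /andP[exy _] cs].
  by rewrite set_nil setU0; apply: connected_set1.
by apply: connected_setU1 cs _ exy; rewrite inE mem_head.
Qed.

Lemma component_of_id S x : x \in S -> x \in component_of e S x.
Proof. by move=> xS; rewrite inE xS connect0. Qed.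

Lemma component_of_closed S x u v :
  u \in component_of e S x -> v \in S -> e u v -> v \in component_of e S x.
Proof.
rewrite !inE => /andP[uS xu] vS euv; rewrite vS /=.
by apply: connect_trans xu (connect1 _); rewrite /= uS vS.
Qed.

Lemma component_of_connected S x :
  x \in S -> connected_set (component_of e S x).
Proof.
move=> xS; set C := component_of e S x.
have reach p y : y \in C -> path (induced_rel S) y p ->
    connect (induced_rel C) y (last y p).
  elim: p y => [|z p IH] y yC /=; first by move=> _; apply: connect0.
  case/andP=> /and3P[_ zS eyz] zp; have zC := component_of_closed yC zS eyz.
  apply: connect_trans (IH z zC zp); apply: connect1.
  by rewrite induced_relE yC zC.
apply: (@connected_set_center _ x) => u; rewrite inE => /andP[_].
by case/connectP=> p xp ->; apply: reach => //; apply: component_of_id.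
Qed.

Lemma connected_sub_component_of S C x : connected_set C -> C \subset S ->
  x \in C -> C \subset component_of e S x.
Proof.
move=> cC /subsetP CS xC.
apply: (connected_set_sub cC xC (component_of_id (CS x xC))) => u v _ vC euv ux.
exact: component_of_closed ux (CS v vC) euv.
Qed.

Lemma componentsP S D : D \in components e S ->
  [/\ connected_set D, D \subset S, D != set0
    & forall u v, u \in D -> v \in S -> e u v -> v \in D].
Proof.
case/imsetP=> x xS ->; split.
- exact: component_of_connected.
- by apply/subsetP=> z; rewrite inE => /andP[].
- by apply/set0Pn; exists x; apply: component_of_id.
- exact: component_of_closed.
Qed.

Lemma nbhd_setP D v :
  reflect (v \notin D /\ exists2 u, u \in D & e u v) (v \in nbhd_set e D).
Proof.
by rewrite inE; apply: (iffP andP) => -[vD uDv]; split=> //; apply/exists_inP.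
Qed.

Lemma nbhd_setS C D v :
  D \subset C -> v \notin C -> v \in nbhd_set e D -> v \in nbhd_set e C.
Proof.
move=> /subsetP DC vC /nbhd_setP[_ [u uD euv]].
by apply/nbhd_setP; split=> //; exists u; rewrite ?DC.
Qed.

(** * Induced paths and holes *)

Lemma induced_path1 x : induced_path e [:: x] x x.
Proof. by split=> // u v; rewrite !inE => /eqP-> /eqP->; rewrite e_irr /= eqxx. Qed.

Lemma induced_path_ends s x y :
  induced_path e s x y -> [/\ s != [::], x \in s & y \in s].
Proof. by case: s => [|z s] [] // _ [->] /= <- _; rewrite mem_head mem_last. Qed.

Lemma induced_path_catP s t x y : s != [::] -> t != [::] ->
  induced_path e (s ++ t) x y <-> exists b c,
    [/\ induced_path e s x b, induced_path e t c y, [disjoint s & t]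
      & {in s & t, forall u v, e u v = (u == b) && (v == c)}].
Proof.
case: s t => [//|a s] [//|c t] _ _; set p := a :: s; set q := c :: t.
have indexp u : u \in p -> index u (p ++ q) = index u p.
  by move=> pu; rewrite index_cat pu.
have indexq v : v \in q -> v \notin p -> index v (p ++ q) = size p + index v q.
  by move=> qv pv; rewrite index_cat (negPf pv).
have ltp u : u \in p -> index u p < size p by rewrite index_mem.
have consecutive i j n : i < n ->
    (i == n.-1) && (j == 0) = (n + j == i.+1) || (i == (n + j).+1) by lia.
have disE : [disjoint p & q] = ~~ has (mem p) q.
  by rewrite disjoint_has has_sym.
split=> [[]|[b [c' [[up xp bp indp] [uq c'q yq indq] dis edge]]]].
  rewrite cat_uniq last_cat -disE => /and3P[up dis uq] xp yq ind.
  have notp v : v \in q -> v \notin p by move/(disjointFl dis)->.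
  exists (last a s), c; split=> //; first split=> //.
  - by move=> u v pu pv; rewrite ind ?mem_cat ?pu ?pv // !indexp.
  - split=> // u v qu qv; rewrite ind ?mem_cat ?qu ?qv ?orbT //.
    by rewrite !indexq ?notp // -!addnS !eqn_add2l.
  move=> u v pu qv; rewrite ind ?mem_cat ?pu ?qv ?orbT //.
  rewrite (indexp u) // (indexq v) ?notp // -(consecutive (index u p)) ?ltp //.
  by rewrite -(@eq_head_index _ q c) // -(@eq_last_index _ p a).
have notp v : v \in q -> v \notin p by move/(disjointFl dis)->.
have cross u v : u \in p -> v \in q ->
    e u v = (index v (p ++ q) == (index u (p ++ q)).+1)
         || (index u (p ++ q) == (index v (p ++ q)).+1).
  move=> pu qv; rewrite edge // -bp (eq_last_index _ up) // (eq_head_index _ c'q).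
  by rewrite (indexp u) // (indexq v) ?notp // consecutive ?ltp.
split; rewrite ?last_cat //; first by rewrite cat_uniq up uq -disE dis.
move=> u v; rewrite !mem_cat; case/orP=> su /orP[] sv.
- by rewrite indp // !indexp.
- exact: cross.
- by rewrite e_sym cross // orbC.
- by rewrite indq // !indexq ?notp // -!addnS !eqn_add2l.
Qed.

Lemma induced_path_consP a s x y : s != [::] ->
  induced_path e (a :: s) x y <->
  a = x /\ exists c, [/\ induced_path e s c y, a \notin s
                      & {in s, forall v, e a v = (v == c)}].
Proof.
move=> s0; rewrite -cat1s (induced_path_catP x y (isT : [:: a] != [::]) s0).
split=> [[b [c [ipa ips dis edge]]]|[<- [c [ips als edge]]]].
  have [_ [ax] /= ab _] := ipa; split=> //; exists c; split=> //.
    by rewrite disjoint_has /= orbF in dis.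
  by move=> v vs; rewrite edge ?mem_head // ab eqxx.
exists a, c; split=> //; first exact: induced_path1.
  by rewrite disjoint_has /= orbF.
by move=> u v; rewrite inE => /eqP-> vs; rewrite edge // eqxx.
Qed.

Lemma induced_path_split_head s x y : induced_path e s x y -> x != y ->
  exists r c, [/\ s = x :: r, induced_path e r c y, x \notin r
                & {in r, forall v, e x v = (v == c)}].
Proof.
case: s => [|z [|v r]] ip xy; first by case: ip.
  by case: ip xy => _ [<-] /= <-; rewrite eqxx.
case/induced_path_consP: ip => // -> [c [ipr xr edge]].
by exists (v :: r), c.
Qed.

Lemma induced_path_sorted s x y : induced_path e s x y -> sorted e s.
Proof.
elim: s x => [|a [|c s] IH] x // /induced_path_consP[] // _ [c' [ips _ edge]].
have [_ [def_c'] _ _] := ips; subst c'.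
by rewrite /= edge ?mem_head // eqxx; apply: IH ips.
Qed.

Lemma induced_path_rev s x y :
  induced_path e s x y -> induced_path e (rev s) y x.
Proof.
elim: s x => [|a [|c s] IH] x.
- by case.
- by case=> _ [<-] /= <- _; apply: induced_path1.
case/induced_path_consP=> // <- [c' [ips als edge]].
rewrite rev_cons -cats1; apply/induced_path_catP => //.
  by rewrite -size_eq0 size_rev.
exists c', a; split; [exact: IH | exact: induced_path1 | |].
  by rewrite disjoint_sym disjoint_has /= mem_rev orbF.
move=> u v; rewrite mem_rev => su /[1!inE] /eqP->.
by rewrite e_sym edge // eqxx andbT.
Qed.

Lemma induced_path_prefix s t v x y :
  induced_path e (rcons s v ++ t) x y -> induced_path e (rcons s v) x v.
Proof.
case: t => [|c t].
  by rewrite cats0 => -[us xs _ ind]; split; rewrite ?last_rcons.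
move/induced_path_catP; case=> // [|b [_ [ip _ _ _]]]; first by case: (s).
by have [_ _ vb _] := ip; rewrite last_rcons in vb; rewrite {2}vb.
Qed.

Lemma induced_path_join s t x y z : induced_path e s x y ->
  induced_path e (y :: t) y z -> y != z ->
  {in s & t, forall u v, u != y -> u != v /\ ~~ e u v} ->
  induced_path e (s ++ t) x z.
Proof.
move=> ips ipt yz apart.
have [r [c [[def_r] ipr yr edge_y]]] := induced_path_split_head ipt yz; subst r.
have [s0 _ _] := induced_path_ends ips.
have [t0 _ _] := induced_path_ends ipr.
apply/induced_path_catP => //; exists y, c; split=> //.
  rewrite disjoint_has; apply/hasPn => u su; apply: contra yr => tu.
  by have [<-//|uy] := eqVneq u y; have [/eqP] := apart u u su tu uy.
move=> u v su tv; have [->|uy] := eqVneq u y; first exact: edge_y.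
by apply/negbTE; have [] := apart u v su tv uy.
Qed.

Lemma induced_path_cut s x y z : induced_path e s y z -> x \in s -> x != y ->
  exists s1 s2, [/\ s = y :: rcons s1 x ++ s2,
    induced_path e (y :: rcons s1 x) y x,
    connected_set [set:: s1], connected_set [set:: s2]
    & {in s1 ++ s2, forall v, v \notin [set x; y]}].
Proof.
case: s => [|y' s] ip; first by case: ip.
have [us [def_y'] _ _] := ip; subst y'.
rewrite inE => sx xy; rewrite (negPf xy) /= in sx.
case/path.splitP: sx us ip => s1 s2 us ip; exists s1, s2.
have /= := induced_path_sorted ip; rewrite cat_path rcons_path.
case/andP=> /andP[ys1 _] xs2; split=> //.
- exact: (@induced_path_prefix (y :: s1)) ip.
- exact/sorted_connected_set/(path_sorted ys1).
- exact/sorted_connected_set/(path_sorted xs2).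
move=> v vs12; move: us; rewrite cat_rcons /= -cat1s uniq_catCA /= -cat1s.
rewrite mem_cat mem_cat orbCA -mem_cat inE negb_or => /and3P[/andP[_ ys12] xs12 _].
by rewrite in_set2; apply/norP; split; apply: contraTneq vs12 => ->.
Qed.

Lemma connected_set_induced_path S x y : connected_set S -> x \in S -> y \in S ->
  exists2 s, induced_path e s x y & {subset s <= S}.
Proof.
move=> cS xS yS; have /connectP[p] := cS x y xS yS.
elim/last_ind: p y {yS} => [|p w IH] y /=.
  move=> _ ->; exists [:: x]; first exact: induced_path1.
  by move=> z /[!inE] /eqP->.
rewrite rcons_path last_rcons => /andP[xp /and3P[_ wS epw]] ->.
have [s ips sS] := IH _ xp erefl.
have nbr_s : has [pred v | (v == w) || e v w] s.
  have [_ _ ps] := induced_path_ends ips.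
  by apply/hasP; exists (last x p); rewrite //= epw orbT.
(* Cut the path at its first vertex that is equal or adjacent to [w]. *)
case/split_find: nbr_s ips sS => v s1 s2 /= vw no_nbr /induced_path_prefix ip sS.
have s1S : {subset rcons s1 v <= S} by move=> z zs; rewrite sS // mem_cat zs.
case/predU1P: vw => [<-|evw]; first by exists (rcons s1 v).
have s1w : w \notin rcons s1 v.
  rewrite mem_rcons inE; apply/norP; split.
    by apply: contraTneq evw => ->; rewrite e_irr.
  by apply: contra no_nbr => ws1; apply/hasP; exists w; rewrite //= eqxx.
exists (rcons s1 v ++ [:: w]); last first.
  by move=> z; rewrite mem_cat inE => /orP[/s1S//|/eqP->].
apply/induced_path_catP => //; first by case: (s1).
exists v, w; split; [by [] | exact: induced_path1 | |].
  by rewrite disjoint_sym disjoint_has /= orbF.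
move=> u z; rewrite mem_rcons inE => us /[!inE] /eqP->; rewrite eqxx andbT.
case/predU1P: us => [->|us]; first by rewrite evw eqxx.
have := hasPn no_nbr u us; rewrite negb_or => /andP[_ /negPf->].
by apply/esym/eqP=> uv; have [] := ip; rewrite -uv rcons_uniq us.
Qed.

Lemma induced_path_cat_nbhd_nadj s t x y D a b : induced_path e (s ++ t) x y ->
  connected_set D -> {subset D <= s ++ t} -> a \in s -> b \in t ->
  a \in nbhd_set e D -> b \in nbhd_set e D -> ~~ e a b.
Proof.
move=> ip cD Dst sa tb /nbhd_setP[aD [u uD eua]] /nbhd_setP[bD [v vD evb]].
apply/negP=> eab; case/induced_path_catP: ip => [||a' [b' [_ _ _ edge]]].
- by apply: contraTneq sa => ->.
- by apply: contraTneq tb => ->.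
have := edge a b sa tb; rewrite eab => /esym/andP[/eqP aa' /eqP bb'].
subst a' b'.
have Dt z w : z \in D -> w \in t -> e z w -> z \in t.
  move=> zD tw ezw; have := Dst z zD; rewrite mem_cat => /orP[sz|//].
  have := edge z w sz tw; rewrite ezw => /esym/andP[/eqP za _].
  by rewrite -za zD in aD.
have /subsetP D_sub_t : D \subset [set:: t].
  apply: (connected_set_sub cD vD); first by rewrite inE (Dt v b).
  by move=> z w zD wD ezw; rewrite !inE => /(Dt w z wD)->; rewrite // e_sym.
have tu : u \in t by have := D_sub_t u uD; rewrite inE.
have := edge a u sa tu; rewrite e_sym eua => /esym/andP[_ /eqP ub].
by rewrite -ub uD in bD.
Qed.

Lemma induced_path_nbhd_nadj s x y D a b : induced_path e s x y ->
  connected_set D -> {subset D <= s} -> a \in s -> b \in s ->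
  a \in nbhd_set e D -> b \in nbhd_set e D -> ~~ e a b.
Proof.
move=> ip cD Ds sa sb aD bD; case/path.splitP: sa ip Ds sb => s1 s2 ip Ds.
rewrite mem_cat mem_rcons inE -orbA => /or3P[/eqP->|bs1|bs2].
- by rewrite e_irr.
- rewrite cat_rcons in ip Ds; rewrite e_sym.
  exact: induced_path_cat_nbhd_nadj ip cD Ds bs1 (mem_head a s2) bD aD.
apply: induced_path_cat_nbhd_nadj ip cD Ds _ bs2 aD bD.
by rewrite mem_rcons mem_head.
Qed.

Lemma hole_cons s x a b : induced_path e s a b -> x \notin s -> 3 <= size s ->
  {in s, forall v, e x v = (v == a) || (v == b)} -> hole e (x :: s).
Proof.
move=> ip xs s3 edge_x; have [_ sa _] := induced_path_ends ip.
case: ip => us head_s last_s ind.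
have x_neq u : u \in s -> (x == u) = false by apply: contraTF => /eqP<-.
have next_x v : (next (x :: s) x == v) = (v == a).
  by case: (s) head_s => //= a' s' [->]; rewrite eqxx eq_sym.
have next_s u v : u \in s -> v \in s ->
    (next (x :: s) u == v) = (index v s == (index u s).+1).
  move=> su sv; rewrite next_nth inE su orbT /= x_neq //=.
  have [lt|ge] := ltnP (index u s).+1 (size s).
    by rewrite -(inj_in_eq (@index_inj _ x s)) ?mem_nth // index_uniq // eq_sym.
  by rewrite nth_default // x_neq // ltn_eqF // (leq_trans _ ge) // index_mem.
have next_sx u : u \in s -> (next (x :: s) u == x) = (u == b).
  move=> su; have -> : b = last x s by rewrite -last_s; case: (s) su.
  rewrite eq_last_index // next_nth inE su orbT /= x_neq //=.
  have [lt|ge] := ltnP (index u s).+1 (size s).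
    rewrite eq_sym x_neq ?mem_nth // ltn_eqF //.
    by rewrite -ltnS prednK ?(leq_trans _ lt).
  have -> : size s = (index u s).+1.
    by apply/eqP; rewrite eqn_leq ge index_mem su.
  by rewrite eqxx nth_default ?eqxx.
split; [by rewrite /= xs | by [] |].
move=> u v; rewrite !inE => /predU1P[->|su] /predU1P[->|sv].
- by rewrite e_irr next_x x_neq.
- by rewrite next_x next_sx // edge_x.
- by rewrite e_sym edge_x // next_x // next_sx // orbC.
- by rewrite !next_s // ind.
Qed.

Lemma two_induced_paths_hole s1 s2 x y : induced_path e s1 x y ->
  induced_path e s2 x y -> x != y -> ~~ e x y ->
  {in s1 & s2, forall u v, u \notin [set x; y] -> v \notin [set x; y] ->
    u != v /\ ~~ e u v} ->
  exists c, [/\ hole e c, x \in c, y \in c & {subset c <= s1 ++ s2}].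
Proof.
move=> ip1 ip2 xy xy_nadj apart.
have [r [a [def_s1 ipr xr edge_r]]] := induced_path_split_head ip1 xy.
have [p [b [def_s2 ipp xp edge_p]]] := induced_path_split_head ip2 xy.
have [[_ ra ry] [_ pb _]] := (induced_path_ends ipr, induced_path_ends ipp).
have yb : y != b by apply: contraNneq xy_nadj => ->; rewrite edge_p.
have ip_rev := induced_path_rev ipp.
have [t [c [def_p ipt yt _]]] := induced_path_split_head ip_rev yb.
have [_ _ tb] := induced_path_ends ipt.
have tp : {subset t <= p} by move=> v tv; rewrite -mem_rev def_p inE tv orbT.
have apart_rt : {in r & t, forall u v, u != y -> u != v /\ ~~ e u v}.
  move=> u v ru tv uy; apply: apart; rewrite ?def_s1 ?def_s2 ?inE ?ru ?tp ?orbT //.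
    by rewrite negb_or uy andbT; apply: contraNneq xr => <-.
  apply/norP; split; first by apply: contraNneq xp => <-; apply: tp.
  by apply: contraNneq yt => <-.
have neq_rt u v : u \in r -> v \in t -> u != v.
  move=> ru tv; have [->|uy] := eqVneq u y; first by apply: contraNneq yt => ->.
  by have [] := apart_rt u v ru tv uy.
have ip_rt : induced_path e (r ++ t) a b.
  by apply: induced_path_join ipr _ yb apart_rt; rewrite -def_p.
exists (x :: r ++ t); split.
- apply: (hole_cons ip_rt).
  + by rewrite mem_cat negb_or xr; apply: contra xp; apply: tp.
  + have ay : a != y by apply: contraNneq xy_nadj => <-; rewrite edge_r.
    have r2 : 1 < size r.
      case: (r) ra ry => [|z [|? ?]] //= /[!inE] /eqP az /eqP yz.
      by rewrite az yz eqxx in ay.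
    by rewrite size_cat (leq_add r2) //; case: (t) tb.
  move=> v; rewrite mem_cat => /orP[rv|tv].
    by rewrite edge_r // (negPf (neq_rt v b rv tb)) orbF.
  by rewrite edge_p ?tp // eq_sym (eq_sym v a) (negPf (neq_rt a v ra tv)).
- exact: mem_head.
- by rewrite inE mem_cat ry orbT.
move=> v; rewrite def_s1 def_s2 !inE !mem_cat !inE.
by case/or3P=> [->|->|/tp->]; rewrite ?orbT.
Qed.

Lemma two_connected_sets_hole S1 S2 x y : connected_set S1 -> connected_set S2 ->
  x \in S1 :&: S2 -> y \in S1 :&: S2 -> x != y -> ~~ e x y ->
  {in S1 :\: [set x; y] & S2 :\: [set x; y], forall u v, u != v /\ ~~ e u v} ->
  exists c, [/\ hole e c, x \in c, y \in c & {subset c <= S1 :|: S2}].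
Proof.
move=> cS1 cS2 /setIP[xS1 xS2] /setIP[yS1 yS2] xy xy_nadj apart.
have [s1 ip1 s1S] := connected_set_induced_path cS1 xS1 yS1.
have [s2 ip2 s2S] := connected_set_induced_path cS2 xS2 yS2.
have [|c [hc xc yc cs]] := two_induced_paths_hole ip1 ip2 xy xy_nadj.
  by move=> u v /s1S uS /s2S vS uxy vxy; apply: apart; apply/setDP.
exists c; split=> // z /cs; rewrite mem_cat inE.
by case/orP=> [/s1S->|/s2S->]; rewrite ?orbT.
Qed.

Lemma sparse_hole_nbr_uniq c v a b : triangle_free e -> sparse e -> hole e c ->
  v \notin c -> a \in c -> b \in c -> e v a -> e v b -> a = b.
Proof.
move=> triF sparse_e hc vc ac bc eva evb.
have [a' [b' [_ _ eab nbrs]]] := sparse_e c v hc vc.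
apply/eqP; apply: contraT => ab; case: triF; exists v, a, b; split=> //.
case: (nbrs a ac eva) (nbrs b bc evb) ab => -> [] ->; rewrite ?eqxx //.
by rewrite e_sym.
Qed.

Lemma triangle_free_clique_card K : triangle_free e -> clique e K -> #|K| <= 2.
Proof.
move=> triF cK; rewrite leqNgt; apply/negP.
case/card_gt2P=> x [y [z [[xK yK zK] [xy yz zx]]]].
by apply: triF; exists x, y, z; split; apply: cK => //; rewrite eq_sym.
Qed.

Lemma triangle_free_two_cliques_card K L :
  triangle_free e -> clique e K -> clique e L -> #|K :|: L| <= 4.
Proof.
move=> triF /(triangle_free_clique_card triF) K2.
move=> /(triangle_free_clique_card triF) L2.
exact: leq_trans (leq_card_setU K L) (leq_add K2 L2).
Qed.

(** * The two sides of a separation *)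

Section Separations.
Variables (R : realFieldType) (w : T -> R) (d : nat).
Hypotheses (w_weight : weight_function w) (unb : unbalanced e w d).

Local Notation A := (Apart e w).
Local Notation B := (Bpart e w).

Lemma heavy_sets_meet C D : (2^-1 < weight w C)%R -> (2^-1 < weight w D)%R ->
  exists2 z, z \in C & z \in D.
Proof.
move=> hC hD; have [w01 w1] := w_weight.
have [dis|/pred0Pn[z /andP[zC zD]]] := boolP [disjoint C & D]; last by exists z.
have : (weight w C + weight w D <= 1)%R.
  rewrite /weight -w1 -bigU //= [leRHS](bigID [predU C & D]) /= lerDl.
  by apply: sumr_ge0 => x _; case/andP: (w01 x).
by rewrite leNgt [1%R]splitr !mul1r ltrD.
Qed.

Lemma BpartC K1 K2 : B K1 K2 = B K2 K1.
Proof. by rewrite /Bpart setUC. Qed.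

Lemma ApartC K1 K2 : A K1 K2 = A K2 K1.
Proof. by rewrite /Apart BpartC setUAC. Qed.

Lemma in_Apart K1 K2 v :
  (v \in A K1 K2) = (v \notin B K1 K2) && (v \notin K1 :|: K2).
Proof. by rewrite !inE -orbA negb_or. Qed.

Lemma Apart_disjoint K1 K2 : [disjoint A K1 K2 & K1 :|: K2].
Proof. by apply/pred0P=> v /=; rewrite in_Apart -andbA andNb andbF. Qed.

Lemma Apart_Bpart_disjoint K1 K2 : [disjoint A K1 K2 & B K1 K2].
Proof. by apply/pred0P=> v /=; rewrite in_Apart andbAC andNb. Qed.

Lemma sides_cover K1 K2 v :
  [\/ v \in A K1 K2, v \in B K1 K2 | v \in K1 :|: K2].
Proof.
by apply/or3P; rewrite in_Apart; case: (v \in B _ _); case: (v \in _ :|: _).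
Qed.

Lemma ApartS K1 K2 L1 L2 : B L1 L2 \subset B K1 K2 ->
  [disjoint A K1 K2 & L1 :|: L2] -> A K1 K2 \subset A L1 L2.
Proof.
move=> /subsetP BB AL; apply/subsetP=> v vA.
rewrite in_Apart (disjointFr AL) // andbT.
by apply: contraL vA => /BB /(disjointFl (Apart_Bpart_disjoint K1 K2))->.
Qed.

Lemma notin_Bpart_on_path K1 K2 s : [set z in s] = A K1 K2 :|: K1 :|: K2 ->
  {subset ~: B K1 K2 <= s}.
Proof.
move=> /setP sE v; rewrite in_setC => vB.
by have := sE v; rewrite -setUA in_setU in_Apart vB inE => ->; apply: orNb.
Qed.

Section SmallSeparator.
Variables K1 K2 : {set T}.
Hypothesis K_small : #|K1 :|: K2| <= d.

Lemma Bpart_component : B K1 K2 \in components e (~: (K1 :|: K2)).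
Proof. by have [] := heavy_componentP e_sym w_weight unb K_small. Qed.

Lemma Bpart_heavy : (2^-1 < weight w (B K1 K2))%R.
Proof. by have [] := heavy_componentP e_sym w_weight unb K_small. Qed.

Lemma Bpart_connected : connected_set (B K1 K2).
Proof. by have [] := componentsP Bpart_component. Qed.

Lemma Bpart_disjoint : [disjoint B K1 K2 & K1 :|: K2].
Proof.
by have [_ BK _ _] := componentsP Bpart_component; rewrite disjoints_subset.
Qed.

Lemma Bpart_closed u v :
  u \in B K1 K2 -> e u v -> v \notin K1 :|: K2 -> v \in B K1 K2.
Proof.
have [_ _ _ closedB] := componentsP Bpart_component => uB euv vK.
by apply: closedB uB _ euv; rewrite in_setC.
Qed.

Lemma connected_sub_Bpart C x : connected_set C -> [disjoint C & K1 :|: K2] ->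
  x \in C -> x \in B K1 K2 -> C \subset B K1 K2.
Proof.
move=> cC CK xC xB; apply: (connected_set_sub cC xC xB) => u v _ vC euv uB.
by apply: Bpart_closed uB euv _; rewrite (disjointFr CK).
Qed.

Lemma heavy_sub_Bpart C : connected_set C -> [disjoint C & K1 :|: K2] ->
  (2^-1 < weight w C)%R -> C \subset B K1 K2.
Proof.
move=> cC CK hC; have [x xC xB] := heavy_sets_meet hC Bpart_heavy.
exact: connected_sub_Bpart xC xB.
Qed.

Lemma Bpart_sub_heavy C : (2^-1 < weight w C)%R ->
  {in C, forall u v, e u v -> v \notin K1 :|: K2 -> v \in C} ->
  B K1 K2 \subset C.
Proof.
move=> hC closedC; have [x xB xC] := heavy_sets_meet Bpart_heavy hC.
apply: (connected_set_sub Bpart_connected xB xC) => u v _ vB euv uC.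
by apply: closedC euv _; rewrite // (disjointFr Bpart_disjoint).
Qed.

Lemma Apart_Bpart_nadj : {in A K1 K2 & B K1 K2, forall u v, ~~ e u v}.
Proof.
move=> u v; rewrite in_Apart => /andP[uB uK] vB; apply: contra uB => euv.
by apply: Bpart_closed vB _ uK; rewrite e_sym.
Qed.

Lemma Apart_closed u v :
  u \in A K1 K2 -> e u v -> v \notin K1 :|: K2 -> v \in A K1 K2.
Proof.
move=> uA euv vK; have [//|vB|] := sides_cover K1 K2 v; last by rewrite (negPf vK).
by have := Apart_Bpart_nadj uA vB; rewrite euv.
Qed.

Lemma connected_sub_Apart C x : connected_set C -> [disjoint C & K1 :|: K2] ->
  x \in C -> x \in A K1 K2 -> C \subset A K1 K2.
Proof.
move=> cC CK xC xA; apply: (connected_set_sub cC xC xA) => u v _ vC euv uA.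
by apply: Apart_closed uA euv _; rewrite (disjointFr CK).
Qed.

Lemma clique_meeting_Apart_disjoint L x :
  clique e L -> x \in L -> x \in A K1 K2 -> [disjoint L & B K1 K2].
Proof.
move=> cL xL xA; apply/pred0P=> v; apply/negP=> /andP[/= vL vB].
have [xv|xv] := eqVneq x v.
  by rewrite xv (disjointFl (Apart_Bpart_disjoint K1 K2) vB) in xA.
by have := Apart_Bpart_nadj xA vB; rewrite cL.
Qed.

Lemma clique_meeting_Bpart_disjoint L y :
  clique e L -> y \in L -> y \in B K1 K2 -> [disjoint A K1 K2 & L].
Proof.
move=> cL yL yB; apply/pred0P=> v; apply/negP=> /andP[/= vA vL].
by rewrite (disjointFr (clique_meeting_Apart_disjoint cL vL vA) yL) in yB.
Qed.

Lemma nbhd_both_sides_meets_separator D x y : connected_set D ->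
  x \in nbhd_set e D -> y \in nbhd_set e D ->
  x \in A K1 K2 -> y \in B K1 K2 -> exists2 z, z \in D & z \in K1 :|: K2.
Proof.
move=> cD /nbhd_setP[_ [u uD eux]] /nbhd_setP[_ [v vD evy]] xA yB.
have [DK|/pred0Pn[z /andP[]]] := boolP [disjoint D & K1 :|: K2]; last by exists z.
have uA : u \in A K1 K2.
  by apply: Apart_closed xA _ _; rewrite ?(disjointFr DK) // e_sym.
have /subsetP DA := connected_sub_Apart cD DK uD uA.
by have := Apart_Bpart_nadj (DA v vD) yB; rewrite evy.
Qed.

End SmallSeparator.

Lemma BpartS K1 K2 L1 L2 : #|L1 :|: L2| <= d -> K1 :|: K2 \subset L1 :|: L2 ->
  B L1 L2 \subset B K1 K2.
Proof.
move=> L_small KL; have K_small := leq_trans (subset_leq_card KL) L_small.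
apply: heavy_sub_Bpart => //; [exact: Bpart_connected | | exact: Bpart_heavy].
exact: disjointWr KL (Bpart_disjoint L_small).
Qed.

Definition full_part K1 K2 D : Prop :=
  [/\ connected_set D, D != set0, D \subset A K1 K2
    & K1 :|: K2 \subset nbhd_set e D].

Lemma full_partC K1 K2 D : full_part K1 K2 D -> full_part K2 K1 D.
Proof. by rewrite /full_part ApartC setUC. Qed.

Lemma exists_full_part K1 K2 :
  (exists2 D, D \in components e (A K1 K2) & K1 :|: K2 \subset nbhd_set e D) <->
  exists D, full_part K1 K2 D.
Proof.
split=> [[D /componentsP[cD DA D0 _] KD]|]; first by exists D.
case=> D [cD /set0Pn[x xD] DA KD].
exists (component_of e (A K1 K2) x); first exact/imset_f/(subsetP DA).
apply/subsetP=> v vK; apply: nbhd_setS (subsetP KD v vK).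
  exact: connected_sub_component_of.
by apply: contraL vK => /setIdP[/(disjointFr (Apart_disjoint K1 K2))->].
Qed.

Lemma full_part_on_path_stable K1 K2 D s x y : #|K1 :|: K2| <= d ->
  full_part K1 K2 D -> induced_path e s x y -> {subset ~: B K1 K2 <= s} ->
  {in K1 :|: K2 &, forall u v, ~~ e u v}.
Proof.
move=> K_small [cD _ /subsetP DA /subsetP KD] ip Bs u v uK vK.
have Ks k : k \in K1 :|: K2 -> k \in s.
  by move=> kK; apply: Bs; rewrite inE (disjointFl (Bpart_disjoint K_small)).
apply: (induced_path_nbhd_nadj ip cD _ (Ks u uK) (Ks v vK)); try exact: KD.
move=> z /DA zA; apply: Bs.
by rewrite inE (disjointFr (Apart_Bpart_disjoint K1 K2)).
Qed.

(** * Active separations *)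

Lemma proper_sepC K1 K2 : proper_sep e w K1 K2 -> proper_sep e w K2 K1.
Proof.
case=> KD not_path; split; first by rewrite ApartC setUC.
move=> x y Kx Ky [s [ip sE]]; apply: (not_path y x Ky Kx); exists (rev s); split.
  exact: induced_path_rev.
by rewrite ApartC setUAC -sE; apply/setP=> z; rewrite !inE mem_rev.
Qed.

(* [x] and [y] cut the path into pieces: the one between them is [A K1 K2], and
   the one containing [z] lies in [B K1 K2]. *)
Lemma proper_sep_not_on_path K1 K2 x y z s : #|K1 :|: K2| <= d ->
  proper_sep e w K1 K2 -> K1 = [set x] -> K2 = [set y] -> x != y ->
  induced_path e s y z -> z \in B K1 K2 -> ~ {subset ~: B K1 K2 <= s}.
Proof.
move=> K_small [fullK not_path] K1x K2y xy ip zB Bs.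
have [D [_ /set0Pn[u uD] /subsetP DA _]] := (exists_full_part K1 K2).1 fullK.
have Kxy : K1 :|: K2 = [set x; y] by rewrite K1x K2y.
have BK := Bpart_disjoint K_small; have AB := Apart_Bpart_disjoint K1 K2.
have sx : x \in s by apply: Bs; rewrite inE (disjointFl BK) // Kxy !inE eqxx.
have zx : z != x by apply: contraTneq zB => ->; rewrite (disjointFl BK) // Kxy set21.
have [s1 [s2 [def_s ips1 cs1 cs2 offK]]] := induced_path_cut ip sx xy.
have s2z : z \in s2.
  have : z \in x :: s2.
    by have [_ _ <- _] := ip; rewrite def_s /= last_cat last_rcons mem_last.
  by rewrite inE (negPf zx).
have disK t : {subset t <= s1 ++ s2} -> [disjoint [set:: t] & K1 :|: K2].
  move=> ts; apply/pred0P=> v; apply/negP=> /andP[/= /[1!inE] /ts/offK].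
  by rewrite Kxy => /negPf->.
have disK1 := disK s1 (mem_subseq (prefix_subseq s1 s2)).
have disK2 := disK s2 (mem_subseq (suffix_subseq s1 s2)).
have /subsetP s2B : [set:: s2] \subset B K1 K2.
  by apply: (connected_sub_Bpart K_small cs2 disK2 _ zB); rewrite inE.
have As1 v : v \in A K1 K2 -> v \in s1.
  move=> vA; have : v \in s by apply: Bs; rewrite inE (disjointFr AB).
  have := disjointFr (Apart_disjoint K1 K2) vA; rewrite Kxy in_set2 def_s.
  rewrite inE mem_cat mem_rcons inE => /norP[/negPf-> /negPf->] /= /orP[//|vs2].
  by have := s2B v; rewrite inE vs2 (disjointFr AB vA) => /(_ isT).
have /subsetP s1A : [set:: s1] \subset A K1 K2.
  apply: (connected_sub_Apart K_small cs1 disK1 _ (DA u uD)).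
  by rewrite inE As1 // DA.
apply: (not_path x y K1x K2y); exists (rev (y :: rcons s1 x)); split.
  exact: induced_path_rev.
apply/setP=> v; rewrite -setUA in_setU Kxy in_set2 inE mem_rev inE mem_rcons inE.
have <- : (v \in s1) = (v \in A K1 K2).
  by apply/idP/idP => [vs1|/As1]; [apply: s1A; rewrite inE|].
by rewrite orbA (orbC (v == y)) orbC.
Qed.

Lemma active_sepC K1 K2 : active_sep e w K1 K2 -> active_sep e w K2 K1.
Proof.
case=> pK act; split=> [|L1 L2 cL1 cL2 pL]; first exact: proper_sepC.
rewrite (setUC K2) (BpartC K2) -(setUA _ K2) (setUC K2) setUA.
exact: act.
Qed.

Lemma active_sep_Apart_max K1 K2 L1 L2 : active_sep e w K1 K2 ->
  clique e L1 -> clique e L2 -> proper_sep e w L1 L2 ->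
  A K1 K2 \subset A L1 L2 -> A L1 L2 = A K1 K2.
Proof.
move=> [_ act] cL1 cL2 pL AKL.
have [LK|/eqP LK] := eqVneq (L1 :|: L2) (K1 :|: K2).
  by rewrite /Apart /Bpart -!setUA LK.
have [] := act L1 L2 cL1 cL2 pL LK.
rewrite properE -!(setCS (_ :|: _)) -!/(A _ _) AKL negbK => ALK _.
by apply/eqP; rewrite eqEsubset ALK.
Qed.

Lemma Bpart_D1 K1 K2 k : #|K1 :|: K2| <= d ->
  {in B K1 K2, forall b, ~~ e b k} -> B (K1 :\ k) (K2 :\ k) = B K1 K2.
Proof.
move=> K_small kB; have LK : (K1 :\ k) :|: (K2 :\ k) \subset K1 :|: K2.
  by rewrite -setDUl subD1set.
have L_small := leq_trans (subset_leq_card LK) K_small.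
apply/eqP; rewrite eqEsubset; apply/andP; split; last exact: BpartS.
apply: Bpart_sub_heavy => // [|u uB v euv]; first exact: Bpart_heavy.
rewrite -setDUl in_setD1 negb_and negbK => /predU1P[vk|vK].
  by rewrite vk (negPf (kB u uB)) in euv.
exact: Bpart_closed euv vK.
Qed.

Lemma proper_sep_D1 K1 K2 k : #|K1 :|: K2| <= d ->
  clique e K1 -> clique e K2 -> proper_sep e w K1 K2 -> k \in K1 :|: K2 ->
  B (K1 :\ k) (K2 :\ k) = B K1 K2 -> proper_sep e w (K1 :\ k) (K2 :\ k).
Proof.
move=> K_small cK1 cK2 [fullK _] kK BL.
have [D fD] := (exists_full_part K1 K2).1 fullK; have [cD D0 DA KD] := fD.
have LK : (K1 :\ k) :|: (K2 :\ k) \subset K1 :|: K2.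
  by rewrite -setDUl subD1set.
split.
  apply/exists_full_part; exists D; split=> //; last exact: subset_trans KD.
  apply: subset_trans DA (ApartS _ _); first by rewrite BL.
  exact: disjointWr LK (Apart_disjoint K1 K2).
move=> a b K1a K2b [s [ip sE]].
have Bs := notin_Bpart_on_path sE; rewrite BL in Bs.
have stableK := full_part_on_path_stable K_small fD ip Bs.
have [c cK] : exists2 c, c \in K1 :|: K2 & e k c.
  case/setUP: kK => [kK1|kK2].
    have /setD1P[ak aK1] : a \in K1 :\ k by rewrite K1a set11.
    by exists a; [rewrite inE aK1 | apply: cK1; rewrite // eq_sym].
  have /setD1P[bk bK2] : b \in K2 :\ k by rewrite K2b set11.
  by exists b; [rewrite inE bK2 orbT | apply: cK2; rewrite // eq_sym].
exact/negP/stableK.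
Qed.

(* Otherwise dropping [k] from [K1] and [K2] would enlarge [A K1 K2]. *)
Lemma active_sep_attached K1 K2 k : #|K1 :|: K2| <= d ->
  clique e K1 -> clique e K2 -> active_sep e w K1 K2 -> k \in K1 :|: K2 ->
  exists2 b, b \in B K1 K2 & e b k.
Proof.
move=> K_small cK1 cK2 act kK.
apply/exists_inP; apply: contraT => /exists_inPn kB.
have BL := Bpart_D1 K_small kB.
have pL := proper_sep_D1 K_small cK1 cK2 act.1 kK BL.
have cD1 K : clique e K -> clique e (K :\ k).
  by move=> cK u v /setD1P[_ uK] /setD1P[_ vK]; apply: cK.
have kA : k \in A (K1 :\ k) (K2 :\ k).
  rewrite in_Apart BL -setDUl !inE eqxx andbT.
  by rewrite (disjointFl (Bpart_disjoint K_small) kK).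
suff AA : A (K1 :\ k) (K2 :\ k) = A K1 K2.
  by rewrite AA (disjointFl (Apart_disjoint K1 K2) kK) in kA.
apply: active_sep_Apart_max act _ _ pL _; [exact: cD1 | exact: cD1 |].
apply: ApartS; first by rewrite BL.
by apply: disjointWr (Apart_disjoint K1 K2); rewrite -setDUl subD1set.
Qed.

Lemma active_sep_nested K1 K2 L1 L2 :
  #|K1 :|: K2| <= d -> #|L1 :|: L2| <= d -> clique e K1 -> clique e K2 ->
  active_sep e w K1 K2 -> active_sep e w L1 L2 ->
  [disjoint B K1 K2 & L1 :|: L2] -> A L1 L2 = A K1 K2.
Proof.
move=> K_small L_small cK1 cK2 actK actL BL.
have [cB hB] := (Bpart_connected K_small, Bpart_heavy K_small).
have BB := heavy_sub_Bpart L_small cB BL hB.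
apply/esym/(active_sep_Apart_max actL cK1 cK2 actK.1)/(ApartS BB).
apply/pred0P=> k; apply/negP=> /andP[/= kA kK].
have [b bB ebk] := active_sep_attached K_small cK1 cK2 actK kK.
by have := Apart_Bpart_nadj L_small kA (subsetP BB b bB); rewrite e_sym ebk.
Qed.

(** * Crossing separations *)

Definition straddles K1 K2 D L1 L2 (x y : T) : Prop :=
  [/\ full_part K1 K2 D, x \in L1, x \in D, y \in L2 & y \in B K1 K2].

Lemma straddlesC K1 K2 D L1 L2 x y :
  straddles K1 K2 D L1 L2 x y -> straddles K2 K1 D L1 L2 x y.
Proof. by case=> /full_partC fD xL xD yL yB; split; rewrite // BpartC. Qed.

Lemma cliques_straddle K1 K2 D L1 L2 x y : #|K1 :|: K2| <= d ->
  clique e L1 -> clique e L2 -> full_part K1 K2 D ->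
  x \in L1 :|: L2 -> x \in D -> y \in L1 :|: L2 -> y \in B K1 K2 ->
  straddles K1 K2 D L1 L2 x y \/ straddles K1 K2 D L2 L1 x y.
Proof.
move=> K_small cL1 cL2 fD xL xD yL yB; have [_ _ /subsetP DA _] := fD.
have y_notin L : clique e L -> x \in L -> y \notin L.
  move=> cL Lx; have LB := clique_meeting_Apart_disjoint K_small cL Lx (DA x xD).
  by rewrite (disjointFl LB).
case/setUP: xL yL => xL; rewrite in_setU (negPf (y_notin _ _ xL)) // ?orbF => yL.
  by left.
by right.
Qed.

Section Crossing.
Variables (K1 K2 L1 L2 D E : {set T}) (x y x' y' : T).
Hypotheses (cK1 : clique e K1) (cK2 : clique e K2).
Hypotheses (cL1 : clique e L1) (cL2 : clique e L2).
Hypothesis KL_small : #|(K1 :|: K2) :|: (L1 :|: L2)| <= d.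
Hypothesis actK : active_sep e w K1 K2.
Hypothesis L_across : straddles K1 K2 D L1 L2 x' y'.
Hypothesis K_across : straddles L1 L2 E K1 K2 x y.

Let K_small : #|K1 :|: K2| <= d.
Proof. exact: leq_trans (subset_leq_card (subsetUl _ _)) KL_small. Qed.

Let L_small : #|L1 :|: L2| <= d.
Proof. exact: leq_trans (subset_leq_card (subsetUr _ _)) KL_small. Qed.

Let xK : x \in K1 :|: K2.
Proof. by have [_ xK1 _ _ _] := K_across; rewrite inE xK1. Qed.

Let yK : y \in K1 :|: K2.
Proof. by have [_ _ _ yK2 _] := K_across; rewrite inE yK2 orbT. Qed.

Let xA : x \in A L1 L2.
Proof. by have [[_ _ /subsetP EA _] _ /EA] := K_across. Qed.

Let x'A : x' \in A K1 K2.
Proof. by have [[_ _ /subsetP DA _] _ /DA] := L_across. Qed.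

Lemma K1_Bpart_disjoint : [disjoint K1 & B L1 L2].
Proof.
by have [_ xK1 _ _ _] := K_across; apply: clique_meeting_Apart_disjoint xA.
Qed.

Lemma L1_Bpart_disjoint : [disjoint L1 & B K1 K2].
Proof.
by have [_ x'L1 _ _ _] := L_across; apply: clique_meeting_Apart_disjoint x'A.
Qed.

Lemma Apart_K2_disjoint : [disjoint A L1 L2 & K2].
Proof.
by have [_ _ _ yK2 yB] := K_across; apply: clique_meeting_Bpart_disjoint yB.
Qed.

Lemma Apart_L2_disjoint : [disjoint A K1 K2 & L2].
Proof.
by have [_ _ _ y'L2 y'B] := L_across; apply: clique_meeting_Bpart_disjoint y'B.
Qed.

Section DisjointCliques.
Hypothesis K1L1 : [disjoint K1 & L1].

Lemma Bpart_K2_L2_sub : B K2 L2 \subset B K1 K2 :&: B L1 L2.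
Proof.
set B0 := B (K1 :|: K2) (L1 :|: L2).
have BK : B0 \subset B K1 K2 by apply: BpartS; rewrite ?subsetUl.
have BL : B0 \subset B L1 L2 by apply: BpartS; rewrite ?subsetUr.
suff B_sub : B K2 L2 \subset B0 by rewrite subsetI !(subset_trans B_sub).
have KL : K2 :|: L2 \subset (K1 :|: K2) :|: (L1 :|: L2).
  by apply: setUSS; apply: subsetUr.
apply: Bpart_sub_heavy (leq_trans (subset_leq_card KL) KL_small) _
  (Bpart_heavy KL_small) _.
move=> u uB v euv; rewrite inE negb_or => /andP[vK2 vL2].
have vAK : v \notin A K1 K2.
  apply/negP=> /(Apart_Bpart_nadj K_small) /(_ (subsetP BK u uB)).
  by rewrite e_sym euv.
have vAL : v \notin A L1 L2.
  apply/negP=> /(Apart_Bpart_nadj L_small) /(_ (subsetP BL u uB)).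
  by rewrite e_sym euv.
apply: (Bpart_closed KL_small uB euv).
rewrite !inE (negPf vK2) (negPf vL2) !orbF; apply/norP; split; apply/negP=> v1.
  have [vA|vB|] := sides_cover L1 L2 v; first by rewrite vA in vAL.
    by rewrite (disjointFr K1_Bpart_disjoint v1) in vB.
  by rewrite inE (negPf vL2) (disjointFr K1L1 v1).
have [vA|vB|] := sides_cover K1 K2 v; first by rewrite vA in vAK.
  by rewrite (disjointFr L1_Bpart_disjoint v1) in vB.
by rewrite inE (negPf vK2) (disjointFl K1L1 v1).
Qed.

Lemma Aparts_sub_Apart_K2_L2 : A K1 K2 :|: A L1 L2 \subset A K2 L2.
Proof.
have /subsetIP[BK BL] := Bpart_K2_L2_sub.
rewrite subUset; apply/andP; split; apply: ApartS => //;
  rewrite disjoints_subset setCU subsetI -!disjoints_subset; apply/andP; split.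
- exact: disjointWr (subsetUr _ _) (Apart_disjoint K1 K2).
- exact: Apart_L2_disjoint.
- exact: Apart_K2_disjoint.
- exact: disjointWr (subsetUr _ _) (Apart_disjoint L1 L2).
Qed.

Lemma full_part_K2_L2 : full_part K2 L2 (D :|: E).
Proof.
have := Aparts_sub_Apart_K2_L2; rewrite subUset => /andP[AK AL].
have [[cD D0 DA KD] _ _ _ _] := L_across.
have [[cE _ EA LE] _ xE _ _] := K_across.
have DEA : D :|: E \subset A K2 L2.
  by rewrite subUset (subset_trans DA AK) (subset_trans EA AL).
split=> //.
- have /nbhd_setP[_ [u uD eux]] := subsetP KD x xK.
  exact: connected_setU eux.
- by rewrite setU_eq0 negb_and D0.
apply/subsetP=> v vKL; have vDE : v \notin D :|: E.
  by apply: contraL vKL => /(subsetP DEA)/(disjointFr (Apart_disjoint K2 L2))->.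
case/setUP: vKL => [vK|vL].
  by apply: nbhd_setS (subsetUl D E) vDE _; rewrite (subsetP KD) // inE vK orbT.
by apply: nbhd_setS (subsetUr D E) vDE _; rewrite (subsetP LE) // inE vL orbT.
Qed.

Lemma proper_sep_K2_L2 : proper_sep e w K2 L2.
Proof.
split; first by apply/exists_full_part; exists (D :|: E); apply: full_part_K2_L2.
have [_ xK1 _ yK2 yB] := K_across; have [fD _ _ y'L2 y'B] := L_across.
move=> a b K2a L2b [s [ip sE]].
have ya : y = a by apply/set1P; rewrite -K2a.
have y'b : y' = b by apply/set1P; rewrite -L2b.
subst a b; have /subsetIP[BK _] := Bpart_K2_L2_sub.
have Bs : {subset ~: B K1 K2 <= s}.
  move=> v vB; apply: (notin_Bpart_on_path sE); move: v vB; apply/subsetP.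
  by rewrite setCS.
have xy : x != y.
  by apply: contraTneq yB => <-; rewrite (disjointFr K1_Bpart_disjoint).
have K1x : K1 = [set x].
  apply/setP=> v; rewrite in_set1; apply/idP/eqP=> [vK1|->//]; apply/eqP.
  have vK : v \in K1 :|: K2 by rewrite inE vK1.
  by apply: contraTT (full_part_on_path_stable K_small fD ip Bs vK xK) => /cK1->.
exact: (proper_sep_not_on_path K_small actK.1 K1x K2a xy ip y'B Bs).
Qed.

End DisjointCliques.

Lemma K1_L1_not_disjoint : ~ [disjoint K1 & L1].
Proof.
move=> K1L1; have := Aparts_sub_Apart_K2_L2 K1L1.
rewrite subUset => /andP[AK /subsetP AL].
have AE := active_sep_Apart_max actK cK2 cL2 (proper_sep_K2_L2 K1L1) AK.
by have := AL x xA; rewrite AE (disjointFl (Apart_disjoint K1 K2) xK).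
Qed.

Section CommonVertex.
Variable p : T.
Hypotheses (pK1 : p \in K1) (pL1 : p \in L1).
Hypotheses (triF : triangle_free e) (sparse_e : sparse e).

Let pK : p \in K1 :|: K2. Proof. by rewrite inE pK1. Qed.

Let pL : p \in L1 :|: L2. Proof. by rewrite inE pL1. Qed.

Let epx : e p x.
Proof.
have [_ xK1 _ _ _] := K_across; apply: cK1 => //.
by apply: contraTneq xA => <-; rewrite (disjointFl (Apart_disjoint L1 L2)).
Qed.

Let epx' : e p x'.
Proof.
have [_ x'L1 _ _ _] := L_across; apply: cL1 => //.
by apply: contraTneq x'A => <-; rewrite (disjointFl (Apart_disjoint K1 K2)).
Qed.

Let xx'_nadj : ~~ e x x'.
Proof. by apply/negP=> exx'; apply: triF; exists p, x, x'. Qed.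

Let x_neq_x' : x != x'.
Proof.
by apply: contraTneq x'A => <-; rewrite (disjointFl (Apart_disjoint K1 K2)).
Qed.

Lemma full_part_meets_L_once v : v \in D -> v \in L1 :|: L2 -> v = x'.
Proof.
have [[_ _ /subsetP DA _] x'L1 _ _ _] := L_across => /DA vA.
case/setUP=> vL; last by rewrite (disjointFr Apart_L2_disjoint) in vL.
apply/eqP; apply: contraT => vx'; case: triF; exists p, v, x'.
split=> //; apply: cL1 => //.
by apply: contraTneq vA => <-; rewrite (disjointFl (Apart_disjoint K1 K2)).
Qed.

Lemma connected_full_part_side Q :
  {in Q, forall u v, e u v -> v \notin L1 :|: L2 -> v \in Q} ->
  connected_set (x' |: D :&: Q).
Proof.
have [[cD _ _ _] _ x'D _ _] := L_across => closedQ.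
apply: connected_setU1I => // u v uD vD euv uQ.
have [vL|vL] := boolP (v \in L1 :|: L2).
  by right; apply: full_part_meets_L_once.
by left; apply: closedQ euv vL.
Qed.

Definition Apart_link : {set T} := x |: (x' |: D :&: A L1 L2).

Definition Bpart_link : {set T} :=
  x |: (B K1 K2 :|: (y |: (x' |: D :&: B L1 L2))).

Lemma Apart_link_connected : connected_set Apart_link.
Proof.
have [[_ _ _ /subsetP KD] _ _ _ _] := L_across.
have /nbhd_setP[_ [u uD eux]] := KD x xK.
have exu : e x u by rewrite e_sym.
have cA : connected_set (x' |: D :&: A L1 L2).
  by apply: connected_full_part_side => s sA t; apply: Apart_closed.
apply: (connected_setU1 cA _ exu); rewrite in_setU1 in_setI uD.
apply/orP; right; apply: (Apart_closed L_small xA exu).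
by apply: contraNN xx'_nadj => /(full_part_meets_L_once uD) <-.
Qed.

Lemma Bpart_link_connected : connected_set Bpart_link.
Proof.
have [_ _ _ _ yB] := K_across; have [[_ _ _ /subsetP KD] _ _ _ _] := L_across.
have attached := active_sep_attached K_small cK1 cK2 actK.
have [[b bB ebx] [b' b'B eb'y]] := (attached x xK, attached y yK).
have cB : connected_set (x' |: D :&: B L1 L2).
  by apply: connected_full_part_side => s sB t; apply: Bpart_closed.
have /nbhd_setP[_ [u uD euy]] := KD y yK.
have [eyu exb] : e y u /\ e x b by rewrite !(e_sym _ u, e_sym _ b).
have cyB : connected_set (y |: (x' |: D :&: B L1 L2)).
  apply: (connected_setU1 cB _ eyu); rewrite in_setU1 in_setI uD.
  have [uL|uL] := boolP (u \in L1 :|: L2).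
    by rewrite (full_part_meets_L_once uD uL) eqxx.
  by rewrite (Bpart_closed L_small yB eyu uL) orbT.
have cBB := connected_setU (Bpart_connected K_small) cyB b'B (setU11 _ _) eb'y.
by apply: (connected_setU1 cBB _ exb); rewrite in_setU bB.
Qed.

Lemma Apart_link_sub u :
  u \in Apart_link :\: [set x; x'] -> u \in A K1 K2 :&: A L1 L2.
Proof.
have [[_ _ /subsetP DA _] _ _ _ _] := L_across.
case/setDP=> uA; rewrite in_set2 => /norP[/negPf ux /negPf ux'].
by move: uA; rewrite !in_setU1 ux ux' => /setIP[/DA uA uAL]; rewrite in_setI uA.
Qed.

Lemma Bpart_link_sub v :
  v \in Bpart_link :\: [set x; x'] -> v \in B K1 K2 :|: B L1 L2.
Proof.
have [_ _ _ _ yB] := K_across.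
case/setDP=> vB; rewrite in_set2 => /norP[/negPf vx /negPf vx'].
move: vB; rewrite in_setU1 vx /= in_setU.
case/orP=> [vBK|]; first by rewrite in_setU vBK.
by rewrite !in_setU1 vx' in_setU => /predU1P[->|/setIP[_ ->]]; rewrite ?yB orbT.
Qed.

Lemma links_apart :
  {in Apart_link :\: [set x; x'] & Bpart_link :\: [set x; x'],
    forall u v, u != v /\ ~~ e u v}.
Proof.
move=> u v /Apart_link_sub/setIP[uA uAL] /Bpart_link_sub/setUP[vB|vB]; split.
- by apply: contraTneq vB => <-; rewrite (disjointFr (Apart_Bpart_disjoint K1 K2)).
- exact: Apart_Bpart_nadj uA vB.
- by apply: contraTneq vB => <-; rewrite (disjointFr (Apart_Bpart_disjoint L1 L2)).
- exact: Apart_Bpart_nadj uAL vB.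
Qed.

Lemma common_vertex_notin_links : p \notin Apart_link :|: Bpart_link.
Proof.
have pxx' : p \notin [set x; x'].
  rewrite in_set2; apply/norP; split.
    by apply: contraTneq epx => ->; rewrite e_irr.
  by apply: contraTneq epx' => ->; rewrite e_irr.
apply/negP=> /setUP[] p_link.
  have /Apart_link_sub/setIP[pA _] : p \in Apart_link :\: [set x; x'] by apply/setDP.
  by move: pK; rewrite (disjointFr (Apart_disjoint K1 K2) pA).
have /Bpart_link_sub : p \in Bpart_link :\: [set x; x'] by apply/setDP.
by rewrite in_setU !(disjointFl (Bpart_disjoint _)) ?pK ?pL.
Qed.

Lemma common_vertex_absurd : False.
Proof.
have x_links : x \in Apart_link :&: Bpart_link by rewrite in_setI !setU11.
have x'_links : x' \in Apart_link :&: Bpart_link.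
  by rewrite in_setI /Apart_link /Bpart_link !(in_setU1, in_setU) eqxx !orbT.
have [c [hc xc x'c c_sub]] := two_connected_sets_hole Apart_link_connected
  Bpart_link_connected x_links x'_links x_neq_x' xx'_nadj links_apart.
have pc : p \notin c by apply: contra common_vertex_notin_links; apply: c_sub.
have := sparse_hole_nbr_uniq triF sparse_e hc pc xc x'c epx epx'.
by apply/eqP.
Qed.

End CommonVertex.

Lemma no_crossing : triangle_free e -> ~ sparse e.
Proof.
move=> triF sparse_e; apply: K1_L1_not_disjoint.
apply/pred0P=> p; apply/negP=> /andP[/= pK1 pL1].
exact: (common_vertex_absurd pK1 pL1).
Qed.

End Crossing.

Lemma active_sep_Apart_disjoint K1 K2 L1 L2 : triangle_free e -> sparse e ->
  #|(K1 :|: K2) :|: (L1 :|: L2)| <= d ->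
  clique e K1 -> clique e K2 -> clique e L1 -> clique e L2 ->
  active_sep e w K1 K2 -> active_sep e w L1 L2 ->
  [disjoint A K1 K2 & L1 :|: L2].
Proof.
move=> triF sparse_e KL_small cK1 cK2 cL1 cL2 actK actL.
have K_small := leq_trans (subset_leq_card (subsetUl _ _)) KL_small.
have L_small := leq_trans (subset_leq_card (subsetUr _ _)) KL_small.
apply/pred0P=> v; apply/negP=> /andP[/= vA vL].
have AKL : A K1 K2 <> A L1 L2.
  by move=> AA; rewrite AA (disjointFl (Apart_disjoint L1 L2) vL) in vA.
have [u uB uL] : exists2 u, u \in B K1 K2 & u \in L1 :|: L2.
  have [BL|/pred0Pn[u /andP[]]] := boolP [disjoint B K1 K2 & L1 :|: L2].
    by case: AKL; rewrite (active_sep_nested K_small L_small _ _ actK actL).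
  by exists u.
have [y yB yK] : exists2 y, y \in B L1 L2 & y \in K1 :|: K2.
  have [BK|/pred0Pn[y /andP[]]] := boolP [disjoint B L1 L2 & K1 :|: K2].
    by case: AKL; rewrite (active_sep_nested L_small K_small _ _ actL actK).
  by exists y.
have [D fD] := (exists_full_part K1 K2).1 actK.1.1.
have [E fE] := (exists_full_part L1 L2).1 actL.1.1.
have [[cD _ _ /subsetP KD] [cE _ /subsetP EA /subsetP LE]] := (fD, fE).
have [x xE xK] :=
  nbhd_both_sides_meets_separator K_small cE (LE v vL) (LE u uL) vA uB.
have [x' x'D x'L] :=
  nbhd_both_sides_meets_separator L_small cD (KD x xK) (KD y yK) (EA x xE) yB.
have K_across := cliques_straddle L_small cK1 cK2 fE xK xE yK yB.
have L_across := cliques_straddle K_small cL1 cL2 fD x'L x'D uL uB.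
have actKC := active_sepC actK.
case: K_across L_across => Ks [] Ls.
- exact: (no_crossing cK1 cK2 cL1 cL2 KL_small actK Ls Ks).
- rewrite (setUC L1) in KL_small.
  exact: (no_crossing cK1 cK2 cL2 cL1 KL_small actK Ls (straddlesC Ks)).
- rewrite (setUC K1) in KL_small.
  exact: (no_crossing cK2 cK1 cL1 cL2 KL_small actKC (straddlesC Ls) Ks).
rewrite (setUC K1) (setUC L1) in KL_small.
exact: (no_crossing cK2 cK1 cL2 cL1 KL_small actKC (straddlesC Ls) (straddlesC Ks)).
Qed.

End Separations.

End Graph.

Theorem theorem5p1 (T : finType) (e : rel T) (R : realFieldType) (w : T -> R)
    (e_sym : symmetric e) (e_irr : irreflexive e)
    (GF2 : class_F2 e)
    (w_weight : weight_function w)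
    (Gw_unb : unbalanced e w 8)
    (no_star : ~ star_cutset e)
    (K1 K2 K1' K2' : {set T})
    (cK1 : clique e K1) (cK2 : clique e K2)
    (cK1' : clique e K1') (cK2' : clique e K2')
    (act : active_sep e w K1 K2) (act' : active_sep e w K1' K2') :
  loosely_non_crossing e w K1 K2 K1' K2'.
Proof.
have [triF sparse_e _ _] := GF2.
have card4 := triangle_free_two_cliques_card triF.
have card8 : #|(K1 :|: K2) :|: (K1' :|: K2')| <= 8.
  apply: leq_trans (leq_card_setU _ _) _.
  exact: (leq_add (card4 _ _ cK1 cK2) (card4 _ _ cK1' cK2')).
split; apply: disjoint_setI0.
  exact: (active_sep_Apart_disjoint e_sym e_irr w_weight Gw_unb).
rewrite setUC in card8.
exact: (active_sep_Apart_disjoint e_sym e_irr w_weight Gw_unb).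
Qed.
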